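(* Let $A$ be a normed vector space, give $A^\vee$ the dual norm, let $X$ be a topological space, let $\kappa\colon X\to\mathrm{Max}\,A$ be a map and let $\kappa^\vee=F\circ\kappa\colon X\to\mathrm{Max}\,A^\vee$. (1) If $(X,A,\kappa)$ and $(X,A^\vee,\kappa^\vee)$ are both quotient vector bundles, then they are both continuous normed quotient vector bundles. (2) If $A$ is locally uniformly convex and $(X,A^\vee,\kappa^\vee)$ is a continuous normed quotient vector bundle, then $(X,A,\kappa)$ is a continuous normed quotient vector bundle. (3) If $A$ is reflexive and Fréchet smooth and $(X,A,\kappa)$ is a continuous normed quotient vector bundle, then $(X,A^\vee,\kappa^\vee)$ is a continuous normed quotient vector bundle.
   Context: Scalars are $\mathbb C$. $\mathrm{Max}\,A$ is the set of closed subspaces of $A$; $A^\vee$ is the space of continuous linear functionals with the dual norm; $F(V)=\{\phi\in A^\vee:\phi|_V=0\}$. The lower Vietoris topology on the set of subspaces of a normed space $B$ is generated by $\{V:V\cap U\ne\emptyset\}$, $U\subset B$ open. A quotient vector bundle is a triple $(X,B,\kappa)$ with $\kappa$ continuous from $X$ into the subspaces of $B$ with the lower Vietoris topology; its associated linear bundle $E$ is the quotient of $B\times X$ by $(a,x)\sim(b,x)\iff a-b\in\kappa(x)$, with quotient map $q$. When $B$ is normed, $(X,B,\kappa)$ is a continuous normed quotient vector bundle if it is a quotient vector bundle and the function $E\to\mathbb R$, $q(a,x)\mapsto\mathrm{dist}(a,\kappa(x))$, is continuous. $A$ is locally uniformly convex if for all $a\in A$ and sequences $(a_n)$, $\lim(2\|a\|^2+2\|a_n\|^2-\|a+a_n\|^2)=0$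 implies $\lim\|a-a_n\|=0$. $A$ is Fréchet smooth if for every $a$ with $\|a\|=1$ the limit $\lim_{\delta\to0}(\|a-\delta b\|-\|a\|)/\delta$ exists uniformly in $b$ with $\|b\|=1$. *)

(* Defs.v *)
From HB Require Import structures.
From mathcomp Require Import all_boot all_order all_algebra.
From mathcomp Require Import all_classical all_reals all_analysis.
From mathcomp Require Import complex.
Set Implicit Arguments. Unset Strict Implicit. Unset Printing Implicit Defensive.
Import Order.TTheory GRing.Theory Num.Theory.
Import numFieldTopology.Exports numFieldNormedType.Exports.
Local Open Scope classical_set_scope.
Local Open Scope ring_scope.

Definition cabs {R : realType} (z : R[i]) : R := ComplexField.Normc.normc z.

Definition is_cnorm {R : realType} (V : lmodType R[i]) (nrm : V -> R) : Prop :=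
  [/\ forall a, 0 <= nrm a,
      forall a, nrm a = 0 -> a = 0,
      forall (c : R[i]) a, nrm (c *: a) = cabs c * nrm a &
      forall a b, nrm (a + b) <= nrm a + nrm b].

Definition ndist {R : realType} (V : lmodType R[i]) (nrm : V -> R) (a b : V) : R :=
  nrm (a - b).

Definition closed_subspace {R : realType} (V : lmodType R[i]) (nrm : V -> R)
  (W : set V) : Prop :=
  [/\ W 0,
      forall a b, W a -> W b -> W (a + b),
      forall (c : R[i]) a, W a -> W (c *: a) &
      forall a, (forall e, 0 < e -> exists w, W w /\ nrm (a - w) < e) -> W a].

Definition dualspace {R : realType} (V : lmodType R[i]) (nrm : V -> R)
  (phi : V -> R[i]) : Prop :=
  [/\ forall a b, phi (a + b) = phi a + phi b,
      forall (c : R[i]) a, phi (c *: a) = c * phi a &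
      forall a e, 0 < e -> exists2 d, 0 < d &
        forall b, nrm (b - a) < d -> cabs (phi b - phi a) < e].

Definition dual_norm {R : realType} (V : lmodType R[i]) (nrm : V -> R)
  (phi : V -> R[i]) : R :=
  sup [set cabs (phi a) | a in [set a | nrm a <= 1]].

Definition dual_dist {R : realType} (V : lmodType R[i]) (nrm : V -> R)
  (phi psi : V -> R[i]) : R :=
  dual_norm nrm (fun a => phi a - psi a).

Definition annih {R : realType} (V : lmodType R[i]) (nrm : V -> R)
  (W : set V) : set (V -> R[i]) :=
  [set phi | dualspace nrm phi /\ forall w, W w -> phi w = 0].

(* ---------- generic notions for a normed space B, presented as a carrier
   S (the elements of B) inside an ambient type, with its norm distance d ---- *)

Definition m_open {R : realType} (B : Type) (S : set B) (d : B -> B -> R)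
  (U : set B) : Prop :=
  U `<=` S /\
  forall a, U a -> exists2 e, 0 < e & forall b, S b -> d a b < e -> U b.

Definition setdist {R : realType} (B : Type) (d : B -> B -> R) (a : B)
  (W : set B) : R :=
  inf [set d a w | w in W].

(* (X, B, kappa) is a quotient vector bundle: kappa (with values in the
   subspaces of B) is continuous for the lower Vietoris topology, whose
   subbasic open sets are {V | V meets U}, U open in B; i.e. the preimage of
   each subbasic open set is open in X. *)
Definition quotient_vb {R : realType} (X : topologicalType) (B : Type)
  (S : set B) (d : B -> B -> R) (kappa : X -> set B) : Prop :=
  (forall x, kappa x `<=` S) /\
  forall U, m_open S d U -> open [set x | exists w, kappa x w /\ U w].

(* continuous normed quotient vector bundle: moreover the function on the
   associated bundle E, q(a,x) |-> dist(a, kappa x), is continuous for the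
   quotient topology of E, i.e. its composite with q is continuous on B x X. *)
Definition cont_normed_qvb {R : realType} (X : topologicalType) (B : Type)
  (S : set B) (d : B -> B -> R) (kappa : X -> set B) : Prop :=
  quotient_vb S d kappa /\
  forall a x, S a -> forall e, 0 < e ->
    exists2 del, 0 < del & exists2 N, nbhs x N &
      forall b y, S b -> d a b < del -> N y ->
        `|setdist d b (kappa y) - setdist d a (kappa x)| < e.

Definition loc_unif_convex {R : realType} (V : lmodType R[i]) (nrm : V -> R)
  : Prop :=
  forall (a : V) (u : nat -> V),
    (fun k => 2 * nrm a ^+ 2 + 2 * nrm (u k) ^+ 2 - nrm (a + u k) ^+ 2)
      @ \oo --> (0 : R) ->
    (fun k => nrm (a - u k)) @ \oo --> (0 : R).

Definition frechet_smooth {R : realType} (V : lmodType R[i]) (nrm : V -> R)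
  : Prop :=
  forall a, nrm a = 1 ->
    exists L : V -> R, forall e, 0 < e -> exists2 eta, 0 < eta &
      forall b (del : R), nrm b = 1 -> 0 < `|del| < eta ->
        `|(nrm (a - (del%:C)%C *: b) - nrm a) / del - L b| < e.

Definition reflexive_space {R : realType} (V : lmodType R[i]) (nrm : V -> R) : Prop :=
  forall Phi : (V -> R[i]) -> R[i],
    (forall phi psi, dualspace nrm phi -> dualspace nrm psi ->
       Phi (fun a => phi a + psi a) = Phi phi + Phi psi) ->
    (forall (c : R[i]) phi, dualspace nrm phi ->
       Phi (fun a => c * phi a) = c * Phi phi) ->
    (forall phi e, dualspace nrm phi -> 0 < e -> exists2 d, 0 < d &
       forall psi, dualspace nrm psi -> dual_dist nrm psi phi < d ->
         cabs (Phi psi - Phi phi) < e) ->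
    exists a : V, forall phi, dualspace nrm phi -> Phi phi = phi a.

(* Main.v *)
Require Import Defs.
From HB Require Import structures.
From mathcomp Require Import all_boot all_order all_algebra.
From mathcomp Require Import all_classical all_reals all_analysis.
From mathcomp Require Import complex.
From mathcomp Require Import ring lra.
Set Implicit Arguments. Unset Strict Implicit. Unset Printing Implicit Defensive.
Import Order.TTheory GRing.Theory Num.Theory.
Import numFieldTopology.Exports numFieldNormedType.Exports.
Local Open Scope classical_set_scope.
Local Open Scope ring_scope.

(** The Hahn-Banach theorem gives the two duality formulas
    [dist(a, W) = max {|phi a| : phi in the annihilator of W, |phi| <= 1}] and
    [dist(phi, annihilator of W) = |phi restricted to W|]. For a lower Vietoris
    continuous [kappa] the distance to [kappa x] is upper semicontinuous, and by
    the duality formulas continuity of one of [kappa], [kappa^vee] makes the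
    distance to the other lower semicontinuous; this is (1). For (2), let [a] be
    a unit vector of [kappa x] and [phi] a norming functional of [a]: for [y]
    near [x] the restriction of [phi] to [kappa y] has norm close to [1], so
    some unit vector [b] of [kappa y] has [|a + b|] close to [2], and local
    uniform convexity puts [b] close to [a]. For (3), let [phi] be a unit vector
    annihilating [kappa x]; by reflexivity [phi a = 1] for some unit vector [a],
    whence [dist(a, kappa x) = 1], so [dist(a, kappa y)] is close to [1] for [y]
    near [x] and is attained by some [psi] in [kappa^vee y]. Smulian's argument
    shows that [psi] is close to [phi] because the norm is Frechet
    differentiable at [a]. *)

(** * Hahn-Banach *)

Definition lin_subspace {K : pzRingType} {E : lmodType K} (S : set E) : Prop :=
  [/\ S 0, forall x y, S x -> S y -> S (x + y) &
      forall (c : K) x, S x -> S (c *: x)].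

Definition linear_on {K : pzRingType} {E : lmodType K} (S : set E) (f : E -> K) :
    Prop :=
  (forall x y, S x -> S y -> f (x + y) = f x + f y) /\
  (forall (c : K) x, S x -> f (c *: x) = c * f x).

Section real_hahn_banach.
Variables (R : realType) (E : lmodType R) (S : set E) (p : E -> R).
Hypothesis linS : lin_subspace S.
Hypothesis pD : forall x y, S x -> S y -> p (x + y) <= p x + p y.
Hypothesis pZ : forall t x, 0 <= t -> S x -> p (t *: x) = t * p x.

(** Partial functionals on [S] below [p] are encoded by their graphs, so that extension becomes
    inclusion. Single-valuedness follows from domination: the difference of two pairs over [x] is
    [(0, r - s)], and [p 0 = 0]. *)
Definition dominated_graph (G : set (E * R^o)) : Prop :=
  lin_subspace G /\ forall x r, G (x, r) -> S x /\ r <= p x.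

Lemma dominated_graph_funct (G : set (E * R^o)) x r s :
  dominated_graph G -> G (x, r) -> G (x, s) -> r = s.
Proof.
move=> [[G0 GD GZ] Gp].
suff le r' s' : G (x, r') -> G (x, s') -> r' <= s'.
  by move=> Gr Gs; apply/eqP; rewrite eq_le !le.
move=> Gr Gs.
have : G (x + -1 *: x, r' + -1 * s') by exact: GD _ _ Gr (GZ (-1) _ Gs).
rewrite scaleN1r subrr => /Gp[S0].
by rewrite -(scale0r (0 : E)) pZ// mul0r mulN1r subr_le0.
Qed.

(* The value [r] at the new vector must satisfy
   [s - p (x - v) <= r <= p (y + v) - s'] for all [(x, s)], [(y, s')] in [G]. *)
Lemma dominated_graph_extend (G : set (E * R^o)) v :
  dominated_graph G -> S v ->
  exists r, dominated_graph
    [set z | exists x s t, G (x, s) /\ z = (x + t *: v, s + t * r)].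
Proof.
move=> [[G0 GD GZ] Gp] Sv; have [S0 SD SZ] := linS.
pose L := [set l | exists x s, G (x, s) /\ l = s - p (x - v)].
have SBv x : S x -> S (x - v).
  by move=> Sx; apply: SD => //; rewrite -scaleN1r; exact: SZ.
(* Since [(x - v) + (y + v) = x + y], subadditivity of [p] puts every lower bound below every upper
   bound. *)
have Lub y s' : G (y, s') -> ubound L (p (y + v) - s').
  move=> Gy _ [x [s [Gx ->]]].
  have [_] : S (x + y) /\ s + s' <= p (x + y) by exact: Gp _ _ (GD _ _ Gx Gy).
  have [Sx _] := Gp _ _ Gx; have [Sy _] := Gp _ _ Gy.
  have := pD (SBv _ Sx) (SD _ _ Sy Sv).
  by rewrite addrACA addNr addr0 => h1 h2; lra.
have supL : has_sup L.
  split; first by exists (0 - p (0 - v)), 0, 0.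
  by exists (p (0 + v) - 0); exact: Lub.
exists (sup L); split; first split.
- by exists 0, 0, 0; rewrite scale0r mul0r !addr0.
- move=> _ _ [x [s [t [Gx ->]]]] [x' [s' [t' [Gx' ->]]]].
  exists (x + x'), (s + s'), (t + t'); split; first exact: GD _ _ Gx Gx'.
  by rewrite scalerDl mulrDl addrACA [s + s' + _]addrACA.
- move=> c _ [x [s [t [Gx ->]]]].
  exists (c *: x), (c * s), (c * t); split; first exact: GZ c _ Gx.
  by rewrite -scalerA -scalerDr -mulrA -mulrDr.
move=> _ _ [x [s [t [Gx [-> ->]]]]].
have [Sx sp] := Gp _ _ Gx; split; first by apply: SD => //; exact: SZ.
(* Dividing by [|t|] reduces to the coefficients [-1] and [1] of [v], where the lower and the upper
   bound on [sup L] apply. *)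
have [t0|t0|->] := ltgtP t 0; last by rewrite scale0r mul0r !addr0.
- have u0 : 0 < - t by lra.
  have Gx' := GZ (- t)^-1 _ Gx.
  have /(ub_le_sup (proj2 supL)) : L ((- t)^-1 * s - p ((- t)^-1 *: x - v)).
    by exists ((- t)^-1 *: x), ((- t)^-1 * s).
  have -> : x + t *: v = (- t) *: ((- t)^-1 *: x - v).
    by rewrite scalerBr scalerA divff ?gt_eqF// scale1r scaleNr opprK.
  rewrite (pZ (ltW u0)); last exact/SBv/SZ.
  move=> /(ler_wpM2l (ltW u0)); rewrite mulrBr mulrA divff ?gt_eqF// mul1r.
  by move=> h; lra.
- have Gx' := GZ t^-1 _ Gx.
  have := @Lub (t^-1 *: x) (t^-1 * s) Gx' => /(sup_le_ub (proj1 supL)).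
  have -> : x + t *: v = t *: (t^-1 *: x + v).
    by rewrite scalerDr scalerA divff ?gt_eqF// scale1r.
  rewrite (pZ (ltW t0)); last by apply: SD => //; exact: SZ.
  move=> /(ler_wpM2l (ltW t0)); rewrite mulrBr mulrA divff ?gt_eqF// mul1r.
  by move=> h; lra.
Qed.

Lemma hahn_banach_real (G0 : set (E * R^o)) : dominated_graph G0 ->
  exists g : E -> R, [/\ linear_on S g, forall x, S x -> g x <= p x &
    forall x r, G0 (x, r) -> g x = r].
Proof.
move=> dG0; have [S0 SD SZ] := linS.
(* Zorn's lemma is applied to sets [A] joined with [G0], so that the empty chain yields [G0]
   itself. *)
pose P (A : set (E * R^o)) := dominated_graph (A `|` G0).
have [|A [PA maxA]] := @Zorn_bigcup _ P.
  move=> F FP totF.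
  have [->|/set0P[A0 FA0]] := eqVneq F set0.
    by rewrite /P bigcup_set0 set0U.
  have common z1 z2 : (\bigcup_(A in F) A `|` G0) z1 ->
      (\bigcup_(A in F) A `|` G0) z2 ->
      exists A, [/\ F A, (A `|` G0) z1 & (A `|` G0) z2].
    move=> [[A1 FA1 Az1]|Gz1] [[A2 FA2 Az2]|Gz2].
    - have [A12|A21] := totF _ _ FA1 FA2.
        by exists A2; split => //; left => //; exact: A12.
      by exists A1; split => //; left => //; exact: A21.
    - by exists A1; split => //; [left|right].
    - by exists A2; split => //; [right|left].
    - by exists A0; split => //; right.
  have sub A z : F A -> (A `|` G0) z -> (\bigcup_(A in F) A `|` G0) z.
    by move=> FA [Az|Gz]; [left; exists A|right].
  split; first split.
  - by right; case: dG0 => -[].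
  - move=> z1 z2 /common /[apply] -[A [FA Az1 Az2]].
    by apply: (sub A) => //; have [[_ + _] _] := FP _ FA; exact.
  - move=> c z /[dup] /common /[apply] -[A [FA Az _]].
    by apply: (sub A) => //; have [[_ _ +] _] := FP _ FA; exact.
  - move=> x r /[dup] /common /[apply] -[A [FA Az _]].
    by have [_] := FP _ FA; exact.
pose M := A `|` G0.
(* The maximal graph lives over all of [S]: a missing [v] could be adjoined by
   [dominated_graph_extend]. *)
have domM v : S v -> exists r, M (v, r).
  move=> Sv; have [r dM'] := dominated_graph_extend PA Sv.
  set M' := (X in dominated_graph X) in dM'.
  have M0 : M (0, 0) by case: PA => -[].
  have sub : M `<=` M'.
    by move=> [x s] Mxs; exists x, s, 0; rewrite scale0r mul0r !addr0.
  have M'v : M' (v, r) by exists 0, 0, 1; rewrite scale1r mul1r !add0r.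
  exists r; apply: contrapT => nMv.
  apply: (maxA M').
    split; first by move=> z Az; apply: sub; left.
    by move=> /(_ _ M'v) Av; apply: nMv; left.
  rewrite /P (_ : M' `|` G0 = M')//; apply/setUidPl => z Gz.
  by apply: sub; right.
have /choice[g gM] : forall x, exists r : R, S x -> M (x, r).
  move=> x.
  have [/domM[r]|nS] := pselect (S x); first by exists r.
  by exists 0.
have [[_ MD MZ] Mp] := PA.
exists g; split.
- split=> [x y Sx Sy|c x Sx].
    apply: (dominated_graph_funct PA (gM _ (SD _ _ Sx Sy))).
    exact: MD _ _ (gM _ Sx) (gM _ Sy).
  apply: (dominated_graph_funct PA (gM _ (SZ c _ Sx))).
  exact: MZ _ _ (gM _ Sx).
- by move=> x /gM /Mp[].
- move=> x r Gxr; have Mxr : M (x, r) by right.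
  have [Sx _] := Mp _ _ Mxr.
  exact: (dominated_graph_funct PA (gM _ Sx) Mxr).
Qed.
End real_hahn_banach.

(** * Modulus and real part of complex numbers *)

Section cabs_theory.
Context {R : realType}.
Implicit Types (z : R[i]) (t : R).

Lemma cabs_ge0 z : 0 <= cabs z.
Proof. by case: z => a b; exact: sqrtr_ge0. Qed.

Lemma cabs0 : cabs (0 : R[i]) = 0. Proof. exact: ComplexField.Normc.normc0. Qed.

Lemma cabs1 : cabs (1 : R[i]) = 1. Proof. exact: ComplexField.Normc.normc1. Qed.

Lemma cabs_eq0 z : cabs z = 0 -> z = 0.
Proof. exact: ComplexField.Normc.eq0_normc. Qed.

Lemma cabsM z z' : cabs (z * z') = cabs z * cabs z'.
Proof. exact: ComplexField.Normc.normcM. Qed.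

Lemma cabsV z : cabs z^-1 = (cabs z)^-1.
Proof. exact: ComplexField.Normc.normcV. Qed.

Lemma cabsD z z' : cabs (z + z') <= cabs z + cabs z'.
Proof. exact: le_normcD. Qed.

Lemma cabsN z : cabs (- z) = cabs z.
Proof. exact: normcN. Qed.

Lemma cabs_real t : cabs (t%:C)%C = `|t|.
Proof. by rewrite /cabs /= expr0n/= addr0 sqrtr_sqr. Qed.

Lemma Re_le_cabs z : complex.Re z <= cabs z.
Proof.
case: z => a b; rewrite /cabs /=; apply: (le_trans (ler_norm a)).
by rewrite -sqrtr_sqr ler_sqrt ?addr_ge0 ?sqr_ge0// lerDl sqr_ge0.
Qed.

Lemma ReD (z z' : R[i]) : complex.Re (z + z') = complex.Re z + complex.Re z'.
Proof. by case: z z' => ? ? [? ?]. Qed.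

Lemma Re_realM (t : R) (z : R[i]) : complex.Re ((t%:C)%C * z) = t * complex.Re z.
Proof. by case: z => ? ? /=; rewrite mul0r subr0. Qed.

Lemma cabs_rotate z : exists2 c, cabs c = 1 & c * z = ((cabs z)%:C)%C.
Proof.
have [->|z0] := eqVneq z 0; first by exists 1; rewrite ?cabs0 ?mulr0// cabs1.
have nz0 : cabs z != 0 by apply: contra z0 => /eqP/cabs_eq0->.
exists (((cabs z)%:C)%C / z); last by rewrite divfK.
by rewrite cabsM cabsV cabs_real ger0_norm ?cabs_ge0// divff.
Qed.

End cabs_theory.

Section realification.
Context {R : realType}.

(** An alias, so that the same vectors can carry a second module structure, over the reals. *)
Definition realification (V : lmodType R[i]) : Type := V.

Variable V : lmodType R[i].

HB.instance Definition _ := GRing.Zmodule.on (realification V).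

Definition real_scale (t : R) (x : realification V) : realification V :=
  (t%:C)%C *: (x : V).

Lemma real_scaleA a b v : real_scale a (real_scale b v) = real_scale (a * b) v.
Proof. by rewrite /real_scale scalerA rmorphM. Qed.
Lemma real_scale1 : left_id 1 real_scale.
Proof. by move=> v; rewrite /real_scale scale1r. Qed.
Lemma real_scaleDr : right_distributive real_scale +%R.
Proof. by move=> t u v; rewrite /real_scale scalerDr. Qed.
Lemma real_scaleDl v : {morph real_scale^~ v : a b / a + b}.
Proof. by move=> a b; rewrite /real_scale rmorphD scalerDl. Qed.

HB.instance Definition _ := GRing.Zmodule_isLmodule.Build R (realification V)
  real_scaleA real_scale1 real_scaleDr real_scaleDl.

End realification.

(** * Hahn-Banach over the complex numbers *)

Section complex_hahn_banach.
Variables (R : realType) (E : lmodType R[i]) (S : set E) (p : E -> R).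
Hypothesis linS : lin_subspace S.
Hypothesis pD : forall x y, S x -> S y -> p (x + y) <= p x + p y.
Hypothesis pZ : forall (c : R[i]) x, S x -> p (c *: x) = cabs c * p x.

(** Real parts are extended first, and the result is complexified. The domain is a subspace [S]
    because the dual space is a subspace of the module of all functions [V -> R[i]]. *)
Lemma hahn_banach (G : set (E * R[i]^o)) : lin_subspace G ->
  (forall x z, G (x, z) -> S x /\ cabs z <= p x) ->
  exists g : E -> R[i], [/\ linear_on S g, forall x, S x -> cabs (g x) <= p x &
    forall x z, G (x, z) -> g x = z].
Proof.
move=> [G0 GD GZ] Gp; have [S0 SD SZ] := linS.
pose GR := [set u : realification E * R^o |
  exists2 z, G (u.1, z) & u.2 = complex.Re z].
have [||||g [[gD gZ] gp gG]] := @hahn_banach_real R (realification E) S p _ _ _ GR.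
- by split => // t x; exact: SZ.
- exact: pD.
- by move=> t x t0 Sx; have := pZ (t%:C)%C Sx; rewrite cabs_real ger0_norm.
- split; first split.
  + by exists 0.
  + move=> [x r] [y s] [z Gz /= ->] [z' Gz' /= ->].
    by exists (z + z'); [exact: GD _ _ Gz Gz'|case: (z) (z') => ? ? [? ?]].
  + move=> t [x r] [z Gz /= ->]; exists ((t%:C)%C * z); first exact: GZ _ _ Gz.
    by case: (z) => a b /=; rewrite mul0r subr0.
  + move=> x r [z /Gp[Sx zp] /= ->]; split => //.
    exact: le_trans (Re_le_cabs _) zp.
(* The complex-linear functional with real part [g]. *)
pose h x : R[i] := (g x +i* - g ('i%C *: x))%C.
have hZ (c : R[i]) x : S x -> h (c *: x) = c * h x.
  move=> Sx; have Six := SZ 'i%C _ Sx.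
  have gZ' (t : R) y : S y -> g ((t%:C)%C *: y) = t * g y by exact: gZ.
  have gcx (a b : R) : g ((a +i* b)%C *: x) = a * g x + b * g ('i%C *: x).
    rewrite (_ : (a +i* b)%C = (a%:C)%C + (b%:C)%C * 'i%C); last first.
      by apply/eqP; rewrite eq_complex /=; apply/andP; split; apply/eqP; ring.
    rewrite scalerDl -scalerA gD; [|exact: SZ..].
    by rewrite !gZ'.
  case: c => a b; rewrite /h scalerA.
  rewrite (_ : 'i%C * (a +i* b)%C = (- b +i* a)%C); last first.
    by apply/eqP; rewrite eq_complex /=; apply/andP; split; apply/eqP; ring.
  rewrite (gcx a b) (gcx (- b) a); apply/eqP; rewrite eq_complex /=.
  by apply/andP; split; apply/eqP; ring.
exists h; split.
- split => // x y Sx Sy; rewrite /h scalerDr !gD//; [|exact: SZ..].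
  by rewrite opprD.
(* For a unimodular [c] making [h (c *: x)] equal to [|h x|], this value is [g (c *: x)], at most
   [p (c *: x) = p x]. *)
- move=> x Sx; have [c c1 cz] := cabs_rotate (h x).
  rewrite -[leRHS]mul1r -c1 -pZ// -[leLHS]/(complex.Re ((cabs (h x))%:C)%C).
  by rewrite -cz -hZ// /h /=; apply/gp/SZ.
- move=> x z Gz.
  (* [G] is stable under multiplication by ['i], so the real parts of [z] and ['i * z] are both
     prescribed for [g]. *)
  have -> : z = (complex.Re z +i* - complex.Re ('i%C * z))%C.
    by case: (z) => a b /=; rewrite mul0r mul1r sub0r opprK.
  congr Complex; first by apply: gG; exists z.
  by congr (- _); apply: gG; exists ('i%C * z) => //; exact: GZ _ _ Gz.
Qed.

Lemma hahn_banach_point a : S a ->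
  exists g : E -> R[i], [/\ linear_on S g, forall x, S x -> cabs (g x) <= p x &
    g a = ((p a)%:C)%C].
Proof.
move=> Sa; have [S0 SD SZ] := linS.
have pa0 : 0 <= p a.
  have : p (a + -1 *: a) <= p a + p (-1 *: a) by apply: pD => //; exact: SZ.
  rewrite scaleN1r subrr -(scale0r a) -scaleN1r !pZ// cabs0 mul0r cabsN.
  by rewrite cabs1 mul1r; lra.
pose G := [set u : E * R[i]^o | exists c, u = (c *: a, c * ((p a)%:C)%C)].
have [||g [glin gp gG]] := @hahn_banach G.
- split.
  + by exists 0; rewrite scale0r mul0r.
  + by move=> _ _ [c ->] [c' ->]; exists (c + c'); rewrite scalerDl mulrDl.
  + by move=> k _ [c ->]; exists (k * c); rewrite -scalerA -mulrA.
- move=> _ _ [c [-> ->]]; split; first exact: SZ.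
  by rewrite cabsM cabs_real ger0_norm// pZ.
exists g; split => //; rewrite (gG a ((p a)%:C)%C)//.
by exists 1; rewrite scale1r mul1r.
Qed.
End complex_hahn_banach.

(** * Distance to the fibres of a bundle *)

Section setdist_theory.
Context {R : realType} {B : Type} {S : set B} {d : B -> B -> R}.
Hypothesis d_ge0 : forall a b, S a -> S b -> 0 <= d a b.
Hypothesis d_sym : forall a b, S a -> S b -> d a b = d b a.
Hypothesis d_tri : forall a b c, S a -> S b -> S c -> d a c <= d a b + d b c.

Lemma setdist_le (a w : B) (W : set B) : S a -> W `<=` S -> W w ->
  setdist d a W <= d a w.
Proof.
move=> Sa WS Ww; apply: ge_inf; last by exists w.
by exists 0 => _ [v Wv <-]; apply: d_ge0 => //; exact: WS.
Qed.

Lemma setdist_ge (a : B) (W : set B) r : W !=set0 ->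
  (forall w, W w -> r <= d a w) -> r <= setdist d a W.
Proof.
move=> [w0 Ww0] h; apply: lb_le_inf; first by exists (d a w0), w0.
by move=> _ [w Ww <-]; exact: h.
Qed.

Lemma setdist_lt_ex (a : B) (W : set B) r : W !=set0 ->
  setdist d a W < r -> exists2 w, W w & d a w < r.
Proof.
move=> W0 lt_r; apply: contrapT => nex.
suff : r <= setdist d a W by rewrite leNgt lt_r.
apply: setdist_ge => // w Ww; rewrite leNgt; apply/negP => dr.
by apply: nex; exists w.
Qed.

Lemma setdist_ge0 (a : B) (W : set B) : S a -> W `<=` S -> W !=set0 ->
  0 <= setdist d a W.
Proof.
by move=> Sa WS W0; apply: setdist_ge => // w /WS; exact: d_ge0.
Qed.

Lemma setdist_lip (a b : B) (W : set B) : S a -> S b -> W `<=` S -> W !=set0 ->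
  setdist d a W <= d a b + setdist d b W.
Proof.
move=> Sa Sb WS W0; rewrite -lerBlDl; apply: setdist_ge => // w Ww.
have := setdist_le Sa WS Ww; have := d_tri Sa Sb (WS _ Ww); lra.
Qed.

Context {X : topologicalType} {kappa : X -> set B}.
Hypothesis kappaS : forall x, kappa x `<=` S.
Hypothesis kappa0 : forall x, kappa x !=set0.
Hypothesis d_refl : forall a, S a -> d a a = 0.

(** Balls suffice: a ball around [w] is open, and an open set that meets [kappa x] at [w] contains
    one. *)
Lemma quotient_vbP : quotient_vb S d kappa <->
  forall x w e, kappa x w -> 0 < e ->
    \forall y \near x, exists2 w', kappa y w' & d w w' < e.
Proof.
split=> [[_ qvb] x w e kw e0|h]; last first.
  split=> // U [US Uo]; rewrite openE => x [w [kw Uw]].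
  have [e e0 eU] := Uo _ Uw.
  apply: filterS (h _ _ _ kw e0) => y [w' kw' dw].
  by exists w'; split => //; apply: eU => //; exact: kappaS kw'.
have Sw := kappaS kw.
have oU : m_open S d [set u | S u /\ d w u < e].
  split=> [u []//|u [Su du]].
  exists (e - d w u); first by rewrite subr_gt0.
  by move=> v Sv duv; split => //; have := d_tri Sw Su Sv; lra.
have /open_nbhs_nbhs : open_nbhs x
    [set y | exists v, kappa y v /\ (S v /\ d w v < e)].
  by split; [exact: qvb oU|exists w; rewrite d_refl].
by apply: filterS => y [v [kv [_ dv]]]; exists v.
Qed.

(* Upper semicontinuity of the distance to [kappa x] is automatic. *)
Lemma cont_normed_qvb_lsc : quotient_vb S d kappa ->
  (forall a x e, S a -> 0 < e ->
     \forall y \near x, setdist d a (kappa x) - e <= setdist d a (kappa y)) ->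
  cont_normed_qvb S d kappa.
Proof.
move=> qvb lsc; split => // a x Sa e e0.
have e3 : 0 < e / 3 by rewrite divr_gt0.
(* A nearly optimal [w] in [kappa x] has a neighbour [w'] in [kappa y], and [d b w'] bounds the new
   distance from above. The lower bound is [lsc] at [a], followed by the Lipschitz estimate from [a]
   to [b]. *)
have [w kw dw] : exists2 w, kappa x w & d a w < setdist d a (kappa x) + e / 3.
  by apply: setdist_lt_ex => //; rewrite ltrDl.
exists (e / 3) => //.
refine (ex_intro2 _ _ _ (filterI (proj1 quotient_vbP qvb _ _ _ kw e3)
  (lsc a x _ Sa e3)) _).
move=> b y Sb dab [[w' kw' dw'] ly].
have l1 := setdist_lip Sa Sb (@kappaS y) (kappa0 y).
have l2 := setdist_le Sb (@kappaS y) kw'.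
have Sw := kappaS kw; have Sw' := kappaS kw'.
have l3 := d_tri Sb Sa Sw'; have l4 := d_tri Sa Sw Sw'.
rewrite (d_sym Sb Sa) in l3.
rewrite ltr_norml; apply/andP; split; lra.
Qed.

End setdist_theory.

(** * The dual norm *)

Section normed_dual.
Context {R : realType} {V : lmodType R[i]} {nrm : V -> R}.
Hypothesis nrmP : is_cnorm nrm.
Let nrm_ge0 : forall a, 0 <= nrm a. Proof. by case: nrmP. Qed.
Let nrm_eq0 : forall a, nrm a = 0 -> a = 0. Proof. by case: nrmP. Qed.
Let nrmZ : forall (c : R[i]) a, nrm (c *: a) = cabs c * nrm a.
Proof. by case: nrmP. Qed.
Let nrmD : forall a b, nrm (a + b) <= nrm a + nrm b. Proof. by case: nrmP. Qed.

Lemma cnorm0 : nrm 0 = 0.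
Proof. by rewrite -(scale0r 0) nrmZ cabs0 mul0r. Qed.

Lemma cnormN a : nrm (- a) = nrm a.
Proof. by rewrite -scaleN1r nrmZ cabsN cabs1 mul1r. Qed.

Lemma cnorm_gt0 a : a != 0 -> 0 < nrm a.
Proof.
move=> a0; rewrite lt_def nrm_ge0 andbT.
by apply: contra a0 => /eqP/nrm_eq0->.
Qed.

Lemma cnormZ_real (t : R) a : 0 <= t -> nrm ((t%:C)%C *: a) = t * nrm a.
Proof. by move=> t0; rewrite nrmZ cabs_real ger0_norm. Qed.

Lemma cnorm_normalize a : a != 0 -> nrm (((nrm a)^-1%:C)%C *: a) = 1.
Proof.
move=> /cnorm_gt0 a0; rewrite cnormZ_real ?invr_ge0// mulVf// gt_eqF//.
Qed.

Lemma ndist_sym a b : ndist nrm a b = ndist nrm b a.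
Proof. by rewrite /ndist -cnormN opprB. Qed.

Lemma ndist_tri a b c : ndist nrm a c <= ndist nrm a b + ndist nrm b c.
Proof. by rewrite /ndist -(subrKA b) nrmD. Qed.

Lemma ndist_refl a : ndist nrm a a = 0.
Proof. by rewrite /ndist subrr cnorm0. Qed.

(** Continuity at 0 with tolerance 1 gives a radius [d]; rescaling [a] to norm [d / 2] gives the
    bound [2 / d]. *)
Lemma dualspace_bounded phi : dualspace nrm phi ->
  exists2 M, 0 <= M & forall a, cabs (phi a) <= M * nrm a.
Proof.
move=> [phiD phiZ phic].
have phi0 : phi 0 = 0 by rewrite -(scale0r 0) phiZ mul0r.
have [d d0 dphi] := phic 0 1 ltr01.
exists (2 / d); first by rewrite divr_ge0// ltW.
move=> a; have [->|a0] := eqVneq a 0; first by rewrite phi0 cabs0 cnorm0 mulr0.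
have na0 := cnorm_gt0 a0.
pose t := d / 2 / nrm a.
have t0 : 0 < t by rewrite !divr_gt0.
have := dphi ((t%:C)%C *: a).
rewrite phi0 !subr0 (cnormZ_real _ (ltW t0)) phiZ cabsM cabs_real gtr0_norm//.
rewrite /t mulfVK ?gt_eqF// => /(_ ltac:(lra)) h.
have -> : 2 / d * nrm a = t^-1 by rewrite /t !invfM !invrK [2 / d]mulrC.
by rewrite -[leRHS]mulr1 -ler_pdivrMl ?invr_gt0// invrK ltW.
Qed.

Lemma bounded_dualspace (phi : V -> R[i]) M : @linear_on _ V setT phi ->
  (forall a, cabs (phi a) <= M * nrm a) -> dualspace nrm phi.
Proof.
move=> [phiD phiZ] phiM; split => [a b|c a|a e e0]; [exact: phiD|exact: phiZ|].
have M1 : 0 < `|M| + 1 by rewrite ltr_wpDl.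
exists (e / (`|M| + 1)); first by rewrite divr_gt0.
move=> b; rewrite ltr_pdivlMr// => h.
have -> : phi b - phi a = phi (b - a).
  by rewrite phiD// -[- a]scaleN1r phiZ// mulN1r.
apply: le_lt_trans (phiM _) _; apply: le_lt_trans h.
by rewrite mulrC ler_wpM2l// (le_trans (ler_norm M))// lerDl.
Qed.

Lemma dual_norm_ub phi a : dualspace nrm phi ->
  cabs (phi a) <= dual_norm nrm phi * nrm a.
Proof.
move=> dphi; have [M M0 phiM] := dualspace_bounded dphi; have [_ phiZ _] := dphi.
have [->|a0] := eqVneq a 0.
  by rewrite cnorm0 mulr0 -(scale0r 0) phiZ mul0r cabs0.
have na0 := cnorm_gt0 a0.
rewrite -ler_pdivrMr//; apply: ub_le_sup.
  exists M => _ [b /= b1 <-]; apply: le_trans (phiM b) _.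
  by rewrite -[leRHS]mulr1 ler_wpM2l.
exists (((nrm a)^-1%:C)%C *: a); first by rewrite /= cnorm_normalize.
by rewrite phiZ cabsM cabs_real ger0_norm ?invr_ge0// mulrC.
Qed.

Lemma dual_norm_le (phi : V -> R[i]) M : 0 <= M ->
  (forall a, cabs (phi a) <= M * nrm a) -> dual_norm nrm phi <= M.
Proof.
move=> M0 phiM; apply: sup_le_ub.
  by exists (cabs (phi 0)), 0 => //=; rewrite cnorm0.
move=> _ [b /= b1 <-]; apply: le_trans (phiM b) _.
by rewrite -[leRHS]mulr1 ler_wpM2l.
Qed.

Lemma dual_norm_ge0 phi : dualspace nrm phi -> 0 <= dual_norm nrm phi.
Proof.
move=> dphi; have [M M0 phiM] := dualspace_bounded dphi.
apply: le_trans (cabs_ge0 (phi 0)) _; apply: ub_le_sup; last first.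
  by exists 0 => //=; rewrite cnorm0.
exists M => _ [b /= b1 <-]; apply: le_trans (phiM b) _.
by rewrite -[leRHS]mulr1 ler_wpM2l.
Qed.

Lemma dualspace_lin_subspace :
  lin_subspace (dualspace nrm : set (V -> R[i]^o)).
Proof.
split.
- apply: (@bounded_dualspace _ 0) => [|a]; last by rewrite cabs0 mul0r.
  by split=> [x y _ _|c x _]; rewrite /= ?addr0 ?mulr0.
- move=> f g df dg; have [[fD fZ _] [gD gZ _]] := (df, dg).
  apply: (@bounded_dualspace _ (dual_norm nrm f + dual_norm nrm g)).
    split=> [x y _ _|c x _]; first by rewrite !fctE fD gD addrACA.
    by rewrite !fctE fZ gZ mulrDr.
  move=> a; rewrite mulrDl; apply: le_trans (cabsD _ _) _.
  by apply: lerD; exact: dual_norm_ub.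
- move=> c f df; have [fD fZ _] := df.
  apply: (@bounded_dualspace _ (cabs c * dual_norm nrm f)).
    split=> [x y _ _|k x _]; first by rewrite !fctE fD scalerDr.
    by rewrite !fctE fZ /GRing.scale/= mulrCA.
  move=> a; rewrite -mulrA -[cabs (_ a)]/(cabs (c * f a)) cabsM.
  by rewrite ler_wpM2l ?cabs_ge0//; exact: dual_norm_ub.
Qed.

Lemma dual_normD phi psi : dualspace nrm phi -> dualspace nrm psi ->
  dual_norm nrm (fun a => phi a + psi a) <= dual_norm nrm phi + dual_norm nrm psi.
Proof.
move=> dphi dpsi; apply: dual_norm_le => [|a].
  by rewrite addr_ge0// dual_norm_ge0.
rewrite mulrDl; apply: le_trans (cabsD _ _) _.
by apply: lerD; exact: dual_norm_ub.
Qed.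

(** One inequality is direct; the other is the same inequality for [c^-1]. *)
Lemma dual_normZ (c : R[i]) phi : dualspace nrm phi ->
  dual_norm nrm (fun a => c * phi a) = cabs c * dual_norm nrm phi.
Proof.
move=> dphi.
have le k f : dualspace nrm f ->
    dual_norm nrm (fun a => k * f a) <= cabs k * dual_norm nrm f.
  move=> df; apply: dual_norm_le => [|a].
    by rewrite mulr_ge0 ?cabs_ge0// dual_norm_ge0.
  by rewrite cabsM -mulrA ler_wpM2l ?cabs_ge0//; exact: dual_norm_ub.
apply/eqP; rewrite eq_le le//=.
have [->|c0] := eqVneq c 0.
  rewrite cabs0 mul0r dual_norm_ge0//.
  by have [_ _ /(_ 0 _ dphi)] := dualspace_lin_subspace.
have dcphi : dualspace nrm (fun a => c * phi a).
  by have [_ _ /(_ c _ dphi)] := dualspace_lin_subspace.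
have := le c^-1 _ dcphi.
under eq_fun do rewrite mulKf//.
rewrite cabsV ler_pdivlMl// lt_def cabs_ge0 andbT.
by apply: contra c0 => /eqP/cabs_eq0->.
Qed.

Lemma dualspaceB phi psi : dualspace nrm phi -> dualspace nrm psi ->
  dualspace nrm (fun a => phi a - psi a).
Proof.
move=> dphi dpsi; have [_ dD dZ] := dualspace_lin_subspace.
have := dD _ _ dphi (dZ (-1) _ dpsi); congr (dualspace nrm _).
by apply/funext => a; rewrite !fctE scaleN1r.
Qed.

Lemma dual_dist_ge0 phi psi : dualspace nrm phi -> dualspace nrm psi ->
  0 <= dual_dist nrm phi psi.
Proof. by move=> dphi dpsi; exact/dual_norm_ge0/dualspaceB. Qed.

Lemma dual_dist_sym phi psi : dualspace nrm phi -> dualspace nrm psi ->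
  dual_dist nrm phi psi = dual_dist nrm psi phi.
Proof.
move=> dphi dpsi; rewrite /dual_dist -[RHS]mul1r -cabs1 -cabsN -dual_normZ.
  by congr (dual_norm nrm _); apply/funext => a; rewrite mulN1r opprB.
exact: dualspaceB.
Qed.

Lemma dual_dist_tri phi psi chi :
  dualspace nrm phi -> dualspace nrm psi -> dualspace nrm chi ->
  dual_dist nrm phi chi <= dual_dist nrm phi psi + dual_dist nrm psi chi.
Proof.
move=> dphi dpsi dchi; rewrite /dual_dist.
apply: le_trans (dual_normD _ _); [|exact: dualspaceB..].
by under [X in _ <= dual_norm _ X]eq_fun do rewrite subrKA.
Qed.

Lemma dual_dist_refl phi : dualspace nrm phi -> dual_dist nrm phi phi = 0.
Proof.
move=> dphi; have -> : dual_dist nrm phi phi = dual_norm nrm (fun a => 0 * phi a).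
  by congr (dual_norm nrm _); apply/funext => a; rewrite subrr mul0r.
by rewrite dual_normZ// cabs0 mul0r.
Qed.

Lemma dual_dist_ub phi psi a : dualspace nrm phi -> dualspace nrm psi ->
  cabs (phi a - psi a) <= dual_dist nrm phi psi * nrm a.
Proof. by move=> dphi dpsi; exact: dual_norm_ub (dualspaceB _ _). Qed.

End normed_dual.

(** * Duality between distances and annihilators *)

Section hahn_banach_consequences.
Context {R : realType} {V : lmodType R[i]} {nrm : V -> R}.
Hypothesis nrmP : is_cnorm nrm.
Let nrm_ge0 : forall a, 0 <= nrm a. Proof. by case: nrmP. Qed.
Let nrmZ : forall (c : R[i]) a, nrm (c *: a) = cabs c * nrm a.
Proof. by case: nrmP. Qed.
Let nrmD : forall a b, nrm (a + b) <= nrm a + nrm b. Proof. by case: nrmP. Qed.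

Let ndist_ge0 (a b : V) : [set: V] a -> [set: V] b -> 0 <= ndist nrm a b.
Proof. by rewrite /ndist. Qed.

Let lin_setT : lin_subspace [set: V]. Proof. by []. Qed.

Lemma norming_functional a : exists phi,
  [/\ dualspace nrm phi, dual_norm nrm phi <= 1 & phi a = ((nrm a)%:C)%C].
Proof.
have [phi [plin pp pa]] :=
  hahn_banach_point lin_setT (fun x y _ _ => nrmD x y) (fun c x _ => nrmZ c x)
    (I : setT a).
have phi1 x : cabs (phi x) <= 1 * nrm x by rewrite mul1r pp.
exists phi; split => //; last exact: dual_norm_le.
exact: bounded_dualspace phi1.
Qed.

Lemma annih_subset (W : set V) : annih nrm W `<=` dualspace nrm.
Proof. by move=> phi []. Qed.

Lemma annih_nonempty (W : set V) : annih nrm W !=set0.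
Proof.
by exists (fun=> 0); split => //; have [] := dualspace_lin_subspace nrmP.
Qed.

Section subspace.
Variable W : set V.
Hypothesis linW : lin_subspace W.
Let W_nonempty : W !=set0. Proof. by exists 0; case: linW. Qed.

Let ndist_le a w : W w -> setdist (ndist nrm) a W <= ndist nrm a w.
Proof. exact: (setdist_le ndist_ge0). Qed.

(** With [setdistZ], this makes the distance to [W], that is, the seminorm induced by the quotient
    by [W], an admissible [p] for Hahn-Banach. *)
Lemma setdistD a b :
  setdist (ndist nrm) (a + b) W <=
  setdist (ndist nrm) a W + setdist (ndist nrm) b W.
Proof.
have [W0 WD WZ] := linW.
rewrite -lerBlDl; apply: setdist_ge => // w' Ww'.
rewrite lerBlDl -lerBlDr; apply: setdist_ge => // w Ww.
rewrite lerBlDr; apply: le_trans (ndist_le _ (WD _ _ Ww Ww')) _.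
by rewrite /ndist opprD addrACA nrmD.
Qed.

Lemma setdistZ (c : R[i]) a :
  setdist (ndist nrm) (c *: a) W = cabs c * setdist (ndist nrm) a W.
Proof.
have [W0 WD WZ] := linW.
have le (k : R[i]) b :
    setdist (ndist nrm) (k *: b) W <= cabs k * setdist (ndist nrm) b W.
  have [->|k0] := eqVneq k 0.
    by rewrite scale0r cabs0 mul0r -(ndist_refl nrmP 0); exact: ndist_le.
  have k1 : 0 < cabs k.
    by rewrite lt_def cabs_ge0 andbT; apply: contra k0 => /eqP/cabs_eq0->.
  rewrite -ler_pdivrMl//; apply: setdist_ge => // w Ww.
  rewrite ler_pdivrMl//; apply: le_trans (ndist_le _ (WZ k _ Ww)) _.
  by rewrite /ndist -scalerBr nrmZ.
apply/eqP; rewrite eq_le le/=.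
have [->|c0] := eqVneq c 0.
  by rewrite cabs0 mul0r; exact: (setdist_ge0 ndist_ge0).
have := le c^-1 (c *: a).
rewrite scalerA mulVf// scale1r cabsV ler_pdivlMl// lt_def cabs_ge0 andbT.
by apply: contra c0 => /eqP/cabs_eq0->.
Qed.

(** The dominating seminorm vanishes on [W], which puts [phi] in the annihilator, and is at most
    [nrm], which bounds its norm by 1. *)
Lemma annih_attains_setdist a : exists phi, [/\ annih nrm W phi,
  dual_norm nrm phi <= 1 & phi a = ((setdist (ndist nrm) a W)%:C)%C].
Proof.
have [W0 WD WZ] := linW.
have [phi [plin pp pa]] :=
  hahn_banach_point lin_setT (fun x y _ _ => setdistD x y)
    (fun c x _ => setdistZ c x) (I : setT a).
have phi1 x : cabs (phi x) <= 1 * nrm x.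
  rewrite mul1r; apply: le_trans (pp x I) (le_trans (ndist_le x W0) _).
  by rewrite /ndist subr0.
exists phi; split => //; last exact: dual_norm_le.
split=> [|w Ww]; first exact: bounded_dualspace phi1.
apply: cabs_eq0; apply/eqP; rewrite eq_le cabs_ge0 andbT.
apply: le_trans (pp w I) (le_trans (ndist_le w Ww) _).
by rewrite ndist_refl.
Qed.

(* A Hahn-Banach extension of [phi] restricted to [W] differs from [phi]
   by an element of the annihilator. *)
Lemma setdist_annih_le phi r : dualspace nrm phi -> 0 <= r ->
  (forall w, W w -> cabs (phi w) <= r * nrm w) ->
  setdist (dual_dist nrm) phi (annih nrm W) <= r.
Proof.
move=> dphi r0 phir; have [W0 WD WZ] := linW; have [phiD phiZ _] := dphi.
have rD (x y : V) : setT x -> setT y -> r * nrm (x + y) <= r * nrm x + r * nrm y.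
  by move=> _ _; rewrite -mulrDr ler_wpM2l.
have rZ (c : R[i]) (x : V) : setT x -> r * nrm (c *: x) = cabs c * (r * nrm x).
  by move=> _; rewrite nrmZ mulrCA.
pose G := [set u : V * R[i]^o | W u.1 /\ u.2 = phi u.1].
have [||psi [psilin psir psiG]] := hahn_banach lin_setT rD rZ (G := G).
- split.
  + by split => //=; rewrite -[RHS]/(phi 0) -(scale0r (0 : V)) phiZ mul0r.
  + move=> [x s] [y t] [/= Wx ->] [/= Wy ->].
    by split; [exact: WD|rewrite /= phiD].
  + by move=> c [x s] [/= Wx ->]; split; [exact: WZ|rewrite /= phiZ].
- by move=> x z [/= Wx ->]; split => //; exact: phir.
have psir' a : cabs (psi a) <= r * nrm a by exact: psir.
have dpsi : dualspace nrm psi by exact: bounded_dualspace psir'.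
apply: le_trans (setdist_le (dual_dist_ge0 nrmP) dphi (@annih_subset W)
  (w := fun a => phi a - psi a) _) _.
  split=> [|w Ww]; first exact: dualspaceB.
  by rewrite (psiG w (phi w)) ?subrr.
rewrite /dual_dist; apply: dual_norm_le => // a.
by rewrite opprB addrC subrK.
Qed.

Lemma setdist_annih_gt phi r : dualspace nrm phi -> 0 <= r ->
  r < setdist (dual_dist nrm) phi (annih nrm W) ->
  exists2 w, W w & r * nrm w < cabs (phi w).
Proof.
move=> dphi r0; apply: contraPP => nex; rewrite ltNge => /negP; apply.
apply: setdist_annih_le => // w Ww; rewrite leNgt; apply/negP => h.
by apply: nex; exists w.
Qed.

(** An annihilating [psi] vanishes at [w], so [|phi w| = |(phi - psi) w|]; the strict hypothesis
    forces [w != 0]. *)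
Lemma setdist_annih_ge phi w r : dualspace nrm phi -> W w ->
  r * nrm w < cabs (phi w) ->
  r <= setdist (dual_dist nrm) phi (annih nrm W).
Proof.
move=> dphi Ww rw; apply: setdist_ge; first exact: annih_nonempty.
move=> psi [dpsi psi0].
have := dual_dist_ub nrmP w dphi dpsi; rewrite psi0// subr0 => h.
have := lt_le_trans rw h.
have [->|w0] := eqVneq w 0; first by rewrite cnorm0// !mulr0 ltxx.
by rewrite ltr_pM2r ?cnorm_gt0// => /ltW.
Qed.

Lemma annih_le_setdist phi a : annih nrm W phi -> dual_norm nrm phi <= 1 ->
  cabs (phi a) <= setdist (ndist nrm) a W.
Proof.
move=> [dphi phi0] phi1; apply: setdist_ge => // w Ww.
have -> : phi a = phi (a - w).
  have [phiD phiZ _] := dphi.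
  by rewrite phiD -[- w]scaleN1r phiZ (phi0 w Ww) mulr0 addr0.
apply: le_trans (dual_norm_ub nrmP _ dphi) _.
by rewrite -[leRHS]mul1r ler_wpM2r.
Qed.

End subspace.

(* By reflexivity, a norming functional of [phi] on the dual is the evaluation
   at some [a]. *)
Lemma reflexive_norm_attained phi : reflexive_space nrm -> dualspace nrm phi ->
  exists2 a, nrm a <= 1 & phi a = ((dual_norm nrm phi)%:C)%C.
Proof.
move=> refl dphi.
have [Phi [[PhiD PhiZ] Phi1 Phiphi]] := @hahn_banach_point R (V -> R[i]^o)
  (dualspace nrm) (dual_norm nrm) (dualspace_lin_subspace nrmP)
  (fun f g => @dual_normD _ _ _ nrmP f g)
  (fun c f => @dual_normZ _ _ _ nrmP c f) phi dphi.
have [||f e df e0|a aPhi] := refl Phi.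
- by move=> f g df dg; exact: PhiD.
- by move=> c f df; exact: PhiZ.
- exists e => // g dg; apply: le_lt_trans.
  have -> : Phi g - Phi f = Phi (fun a => g a - f a).
    have [_ _ dZ] := dualspace_lin_subspace nrmP.
    rewrite -mulN1r -PhiZ// -PhiD//; last exact: dZ.
    by congr Phi; apply/funext => a; rewrite !fctE scaleN1r.
  exact/Phi1/dualspaceB.
exists a; last by rewrite -aPhi.
(* Evaluation at [a] is [Phi], of norm at most 1, so a norming functional of [a] shows
   [nrm a <= 1]. *)
have [psi [dpsi psi1 psia]] := norming_functional a.
have := Phi1 _ dpsi; rewrite aPhi// psia cabs_real ger0_norm// => h.
exact: le_trans h psi1.
Qed.

End hahn_banach_consequences.

(** * Convexity and smoothness *)

Section norm_geometry.
Context {R : realType} {V : lmodType R[i]} {nrm : V -> R}.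
Hypothesis nrmP : is_cnorm nrm.
Let nrm_ge0 : forall a, 0 <= nrm a. Proof. by case: nrmP. Qed.
Let nrmZ : forall (c : R[i]) a, nrm (c *: a) = cabs c * nrm a.
Proof. by case: nrmP. Qed.
Let nrmD : forall a b, nrm (a + b) <= nrm a + nrm b. Proof. by case: nrmP. Qed.

(** The sequential definition in epsilon-delta form: a failure for every [1 / (k + 1)] would give a
    sequence contradicting it. *)
Lemma loc_unif_convex_sphere a e : loc_unif_convex nrm -> nrm a = 1 -> 0 < e ->
  exists2 del, 0 < del & forall b, nrm b = 1 -> 2 - del < nrm (a + b) ->
    nrm (a - b) < e.
Proof.
move=> luc a1 e0; apply: contrapT => nex.
have /choice[u uP] : forall k, exists b,
    [/\ nrm b = 1, 2 - k.+1%:R^-1 < nrm (a + b) & e <= nrm (a - b)].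
  move=> k; apply: contrapT => nk; apply: nex.
  exists k.+1%:R^-1; first by rewrite invr_gt0.
  move=> b b1 hb; rewrite ltNge; apply/negP => le_e.
  by apply: nk; exists b.
have /luc : (fun k => 2 * nrm a ^+ 2 + 2 * nrm (u k) ^+ 2 - nrm (a + u k) ^+ 2)
    @ \oo --> (0 : R).
  (* For [2 - h < s <= 2], [4 - s ^+ 2 = (2 - s) * (2 + s) <= 4 * h]. *)
  apply: (@squeeze_cvgr _ _ _ _ (fun=> 0) (fun k => 4 * harmonic k)).
  - near=> k; have [u1 uk _] := uP k; rewrite a1 u1 /harmonic /=.
    have := nrmD a (u k); rewrite a1 u1 => le2.
    have h0 : 0 < (k.+1%:R^-1 : R) by rewrite invr_gt0.
    have h1 : (k.+1%:R^-1 : R) <= 1 by rewrite invf_le1 ?ler1n.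
    have := nrm_ge0 (a + u k); move: uk le2 h0 h1.
    set s := nrm _; set h := k.+1%:R^-1 => uk le2 h0 h1 s0.
    by rewrite expr1n; apply/andP; split; nra.
  - exact: cvg_cst.
  - rewrite -[0](mulr0 4); apply: cvgMr; exact: cvg_harmonic.
move=> /cvgrPdist_lt/(_ e e0)[k _ /(_ k (leqnn k))].
rewrite /= sub0r normrN ger0_norm// ltNge.
by have [_ _ ->] := uP k.
Unshelve. all: by end_near.
Qed.

Lemma dualspace_Re_le phi a : dualspace nrm phi -> dual_norm nrm phi <= 1 ->
  complex.Re (phi a) <= nrm a.
Proof.
move=> dphi phi1; apply: le_trans (Re_le_cabs _) _.
apply: le_trans (dual_norm_ub nrmP _ dphi) _.
by rewrite -[leRHS]mul1r ler_wpM2r.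
Qed.

(** The difference quotients at [t] and [- t] are both within [e / 2] of [L b]; combining them
    cancels [L b]. *)
Lemma frechet_smooth_second_difference a e : frechet_smooth nrm -> nrm a = 1 ->
  0 < e -> exists2 t, 0 < t & forall b, nrm b = 1 ->
    nrm (a + (t%:C)%C *: b) + nrm (a - (t%:C)%C *: b) <= 2 + e * t.
Proof.
move=> fs a1 e0; have [L hL] := fs a a1.
have [eta eta0 hb] := hL (e / 2) ltac:(by rewrite divr_gt0).
have t0 : 0 < eta / 2 by rewrite divr_gt0.
exists (eta / 2) => // b b1; set t := eta / 2 in t0 *.
have tt : t < eta by rewrite /t; lra.
have := hb b t b1; rewrite gtr0_norm// t0 tt => /(_ isT).
have := hb b (- t) b1; rewrite normrN gtr0_norm// t0 tt => /(_ isT).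
rewrite rmorphN scaleNr opprK a1.
set x := nrm (a + _); set y := nrm (a - _).
have [X xE] : exists X, x = 1 + t * X.
  by exists ((x - 1) / t); rewrite mulrC divfK ?gt_eqF// addrC subrK.
have [Y yE] : exists Y, y = 1 + t * Y.
  by exists ((y - 1) / t); rewrite mulrC divfK ?gt_eqF// addrC subrK.
rewrite xE yE ![1 + _ - 1]addrC !addKr invrN mulrN.
rewrite ![t * _]mulrC !mulfK ?gt_eqF// !ltr_norml => /andP[h1 h2] /andP[h3 h4].
by nra.
Qed.

(* Smulian's argument: [t Re (phi - psi) b] is
   [Re phi (a + t b) + Re psi (a - t b) - Re phi a - Re psi a]. *)
Lemma frechet_smooth_dual_close a e : frechet_smooth nrm -> nrm a = 1 -> 0 < e ->
  exists2 del, 0 < del & forall phi psi, dualspace nrm phi -> dualspace nrm psi ->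
    dual_norm nrm phi <= 1 -> dual_norm nrm psi <= 1 -> phi a = 1 ->
    1 - del < complex.Re (psi a) -> dual_dist nrm phi psi <= e.
Proof.
move=> fs a1 e0.
have [t t0 tP] := frechet_smooth_second_difference fs a1
  (ltac:(by rewrite divr_gt0) : 0 < e / 2).
(* The second difference contributes [t * (e / 2)] and the defect [1 - Re (psi a)] less than another
   [t * (e / 2)]; dividing by [t] leaves [e]. *)
exists (t * (e / 2)); first by rewrite mulr_gt0// divr_gt0.
move=> phi psi dphi dpsi phi1 psi1 phia psia.
apply: dual_norm_le => // [|b]; first exact: ltW.
have dd := dualspaceB nrmP dphi dpsi.
have [->|b0] := eqVneq b 0.
  by apply: le_trans (dual_norm_ub nrmP _ dd) _; rewrite cnorm0// !mulr0.
have nb0 := cnorm_gt0 nrmP b0.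
have [c c1 cE] := cabs_rotate (phi b - psi b).
(* Normalized and rotated so that [phi - psi] takes a nonnegative real value there. *)
pose b' := c *: (((nrm b)^-1%:C)%C *: b).
have b'1 : nrm b' = 1 by rewrite nrmZ c1 mul1r cnorm_normalize.
have [[phiD phiZ _] [psiD psiZ _]] := (dphi, dpsi).
have -> : cabs (phi b - psi b) =
    complex.Re (phi b' - psi b') * nrm b.
  have -> : phi b' - psi b' = ((nrm b)^-1%:C)%C * ((cabs (phi b - psi b))%:C)%C.
    by rewrite -cE /b' !phiZ !psiZ; ring.
  by rewrite Re_realM /= mulrAC mulVf ?mul1r// gt_eqF.
rewrite ler_wpM2r//.
have h1 := dualspace_Re_le (a + (t%:C)%C *: b') dphi phi1.
have h2 := dualspace_Re_le (a - (t%:C)%C *: b') dpsi psi1.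
rewrite phiD phiZ phia ReD Re_realM /= in h1.
rewrite psiD -scaleNr -rmorphN psiZ ReD Re_realM in h2.
rewrite rmorphN scaleNr in h2.
have h3 := tP _ b'1.
have ReB : complex.Re (phi b' - psi b') = complex.Re (phi b') - complex.Re (psi b').
  by case: (phi b') (psi b') => ? ? [? ?].
rewrite ReB -(ler_pM2l t0).
by nra.
Qed.

End norm_geometry.

(** * Bundles *)

Section bundles.
Context {R : realType} {V : lmodType R[i]} {nrm : V -> R}.
Context {X : topologicalType} {kappa : X -> set V}.
Hypothesis nrmP : is_cnorm nrm.
Hypothesis kappaP : forall x, closed_subspace nrm (kappa x).
Let nrm_ge0 : forall a, 0 <= nrm a. Proof. by case: nrmP. Qed.
Let nrmZ : forall (c : R[i]) a, nrm (c *: a) = cabs c * nrm a.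
Proof. by case: nrmP. Qed.
Let nrmD : forall a b, nrm (a + b) <= nrm a + nrm b. Proof. by case: nrmP. Qed.
Let ndist_ge0 (a b : V) : [set: V] a -> [set: V] b -> 0 <= ndist nrm a b.
Proof. by rewrite /ndist. Qed.
Let linkappa x : lin_subspace (kappa x).
Proof. by case: (kappaP x). Qed.
Let kappa0 x : kappa x !=set0. Proof. by exists 0; case: (kappaP x). Qed.
Let kappaT x : kappa x `<=` [set: V]. Proof. by []. Qed.

Local Notation kappaV := (fun x => annih nrm (kappa x)).
Let kappaVS x : kappaV x `<=` dualspace nrm. Proof. exact: annih_subset. Qed.
Let kappaV0 x : kappaV x !=set0. Proof. exact: annih_nonempty. Qed.

Let qvbP := quotient_vbP (fun a b c _ _ _ => ndist_tri nrmP a b c) kappaT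
  (fun a _ => ndist_refl nrmP a).

Let dual_qvbP := quotient_vbP (@dual_dist_tri _ _ _ nrmP) kappaVS
  (@dual_dist_refl _ _ _ nrmP).

(** A [phi] attaining the distance from [a] to [kappa x] is moved to a close [psi] annihilating
    [kappa y], which certifies nearly the same distance. *)
Lemma cont_normed_qvb_of_dual_qvb : quotient_vb setT (ndist nrm) kappa ->
  quotient_vb (dualspace nrm) (dual_dist nrm) kappaV ->
  cont_normed_qvb setT (ndist nrm) kappa.
Proof.
move=> qvb /dual_qvbP qvbV.
apply: (cont_normed_qvb_lsc ndist_ge0
  (fun a b _ _ => ndist_sym nrmP a b) (fun a b c _ _ _ => ndist_tri nrmP a b c)
  kappaT kappa0 (fun a _ => ndist_refl nrmP a) qvb) => a x e _ e0.
have [phi [aphi phi1 phia]] := annih_attains_setdist nrmP (linkappa x) a.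
set D := setdist _ a (kappa x) in phia *.
have D0 : 0 <= D by exact: (setdist_ge0 ndist_ge0 I (@kappaT x)).
have k0 : 0 < nrm a + D + 1 by rewrite ltr_wpDl// addr_ge0.
(* The estimates below give [D <= eta * nrm a + (1 + eta) * |a - w|]. When [|a - w| < D] the loss is
   at most [eta * (nrm a + D)], hence below [e]. *)
have eta0 : 0 < e / (nrm a + D + 1) by rewrite divr_gt0.
apply: filterS (qvbV _ _ _ aphi eta0) => y [psi apsi].
have [dphi _] := aphi; have [dpsi psi0] := apsi.
set eta := e / _ in eta0 *; move=> deta.
apply: setdist_ge => // w kw.
have etaE : eta * (nrm a + D + 1) = e by rewrite divfK// gt_eqF.
have le1 : cabs (phi a - psi a) <= eta * nrm a.
  apply: le_trans (dual_dist_ub nrmP _ dphi dpsi) _.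
  by rewrite ler_wpM2r// ltW.
have le2 : cabs (psi a) <= (1 + eta) * ndist nrm a w.
  have -> : psi a = psi (a - w) - phi (a - w) + phi (a - w).
    have [psiD psiZ _] := dpsi.
    by rewrite subrK psiD -[- w]scaleN1r psiZ (psi0 w kw) mulr0 addr0.
  apply: le_trans (cabsD _ _) _; rewrite addrC mulrDl; apply: lerD.
    apply: le_trans (dual_norm_ub nrmP _ dphi) _; exact: ler_wpM2r.
  rewrite -cabsN opprB; apply: le_trans (dual_dist_ub nrmP _ dphi dpsi) _.
  by rewrite ler_wpM2r// ltW.
have le3 : D <= cabs (phi a - psi a) + cabs (psi a).
  by apply: le_trans (cabsD _ _); rewrite subrK phia cabs_real ler_norm.
have n0 : 0 <= ndist nrm a w by exact: nrm_ge0.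
have [le4|lt4] := leP D (ndist nrm a w); first lra.
nra.
Qed.

(** A [w] in [kappa x] witnessing that [phi] has norm above [D - e] on [kappa x] is moved to a close
    [w'] in [kappa y], and the strict inequality survives. *)
Lemma dual_cont_normed_qvb_of_qvb : quotient_vb setT (ndist nrm) kappa ->
  quotient_vb (dualspace nrm) (dual_dist nrm) kappaV ->
  cont_normed_qvb (dualspace nrm) (dual_dist nrm) kappaV.
Proof.
move=> /qvbP qvb qvbV.
apply: (cont_normed_qvb_lsc (@dual_dist_ge0 _ _ _ nrmP)
  (@dual_dist_sym _ _ _ nrmP) (@dual_dist_tri _ _ _ nrmP)
  kappaVS kappaV0 (@dual_dist_refl _ _ _ nrmP) qvbV) => phi x e dphi e0.
set D := setdist _ phi (annih nrm (kappa x)).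
have [r0|rneg] := leP 0 (D - e); last first.
  near=> y; apply: le_trans (ltW rneg) _.
  exact: (setdist_ge0 (@dual_dist_ge0 _ _ _ nrmP) dphi (@kappaVS y)).
have rD : D - e < D by rewrite gtrDl oppr_lt0.
have [w kw rw] := setdist_annih_gt nrmP (linkappa x) dphi r0 rD.
set r := D - e in r0 rw *.
have phi0 := dual_norm_ge0 nrmP dphi.
have k0 : 0 < dual_norm nrm phi + r + 1 by rewrite ltr_wpDl// addr_ge0.
have gap0 : 0 < cabs (phi w) - r * nrm w by rewrite subr_gt0.
(* Moving [w] by less than this changes [|phi w|] and [r * nrm w] together by less than the gap
   between them. *)
have eta0 := divr_gt0 gap0 k0.
apply: filterS (qvb _ _ _ kw eta0) => y [w' kw'].
set eta := (cabs _ - _) / _ in eta0 *; move=> dw.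
have etaE : eta * (dual_norm nrm phi + r + 1) = cabs (phi w) - r * nrm w.
  by rewrite divfK// gt_eqF.
apply: (setdist_annih_ge nrmP dphi kw').
have le1 : cabs (phi w) <= cabs (phi w') + dual_norm nrm phi * ndist nrm w w'.
  have -> : phi w = phi w' + phi (w - w').
    by have [phiD _ _] := dphi; rewrite -phiD addrC subrK.
  by apply: le_trans (cabsD _ _) _; rewrite lerD2l; exact: dual_norm_ub.
have le2 : nrm w' <= nrm w + ndist nrm w w'.
  by rewrite ndist_sym// -[in leLHS](subrK w w') addrC nrmD.
have n0 : 0 <= ndist nrm w w' by exact: nrm_ge0.
nra.
Unshelve. all: by end_near.
Qed.

Lemma qvb_of_dual_cont_normed : loc_unif_convex nrm ->
  cont_normed_qvb (dualspace nrm) (dual_dist nrm) kappaV ->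
  quotient_vb setT (ndist nrm) kappa.
Proof.
move=> luc [_ contV]; apply/qvbP => x w e kw e0.
have [w0|w0] := eqVneq w 0.
  near=> y; exists w; last by rewrite ndist_refl.
  by rewrite w0; case: (kappaP y).
have nw0 := cnorm_gt0 nrmP w0.
pose a := ((nrm w)^-1%:C)%C *: w.
have a1 : nrm a = 1 by exact: cnorm_normalize.
have ka : kappa x a by case: (kappaP x) => _ _ + _; exact.
(* The tolerance is divided by [nrm w] because [b'] is scaled back by [nrm w] at the end. *)
have [del del0 delP] := loc_unif_convex_sphere nrmP luc a1 (divr_gt0 e0 nw0).
have [phi [dphi phi1 phia]] := norming_functional nrmP a.
(* The minimum with 1 keeps the bound [1 - Num.min del 1] on the restricted norm nonnegative. *)
have del'0 : 0 < Num.min del 1 by rewrite lt_min del0 ltr01.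
have [d d0 [N Nx NP]] := contV phi x dphi _ del'0.
apply: filterS Nx => y /(NP phi y dphi).
rewrite dual_dist_refl// => /(_ d0); rewrite ltr_norml => /andP[+ _].
have D1 : 1 <= setdist (dual_dist nrm) phi (annih nrm (kappa x)).
  apply: setdist_ge => // psi [dpsi psi0].
  have := dual_dist_ub nrmP a dphi dpsi.
  by rewrite psi0// subr0 phia cabs_real a1 normr1 mulr1.
move=> hy.
have r0 : 0 <= 1 - Num.min del 1 by rewrite subr_ge0 ge_min lexx orbT.
have [b kb] := @setdist_annih_gt _ _ _ nrmP _ (linkappa y) phi _ dphi r0
  ltac:(lra).
have [->|b0] := eqVneq b 0.
  have [_ phiZ _] := dphi.
  by rewrite cnorm0// mulr0 -(scale0r (0 : V)) phiZ mul0r cabs0 ltxx.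
have nb0 := cnorm_gt0 nrmP b0.
have [c c1 cE] := cabs_rotate (phi b).
(* After this rotation [phi b'] is real and above [1 - del], so [phi (a + b')] forces
   [nrm (a + b') > 2 - del]. *)
pose b' := c *: (((nrm b)^-1%:C)%C *: b).
have b'1 : nrm b' = 1 by rewrite nrmZ c1 mul1r cnorm_normalize.
have kb' : kappa y b' by case: (kappaP y) => _ _ kZ _; apply: (kZ c); exact: kZ.
have phib' : phi b' = ((cabs (phi b) / nrm b)%:C)%C.
  by have [_ phiZ _] := dphi; rewrite /b' !phiZ mulrCA cE -rmorphM mulrC.
rewrite -ltr_pdivlMr// => hb.
have wE : w = ((nrm w)%:C)%C *: a.
  by rewrite scalerA -rmorphM divff ?gt_eqF// scale1r.
exists (((nrm w)%:C)%C *: b'); first by case: (kappaP y) => _ _ + _; exact.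
rewrite /ndist [in X in X - _]wE -scalerBr cnormZ_real// mulrC -ltr_pdivlMr//.
apply: delP => //; have := dualspace_Re_le nrmP (a + b') dphi phi1.
have [phiD _ _] := dphi; rewrite phiD ReD phia phib' /= a1.
have : Num.min del 1 <= del by rewrite ge_min lexx.
by lra.
Unshelve. all: by end_near.
Qed.

Lemma dual_qvb_of_cont_normed : reflexive_space nrm -> frechet_smooth nrm ->
  cont_normed_qvb setT (ndist nrm) kappa ->
  quotient_vb (dualspace nrm) (dual_dist nrm) kappaV.
Proof.
move=> refl fs [_ cont]; apply/dual_qvbP => x phi e aphi e0.
have [dphi phi0] := aphi.
set n := dual_norm nrm phi.
have : 0 <= n by exact: dual_norm_ge0.
(* A functional of norm 0 vanishes everywhere and lies in every annihilator. *)
rewrite le_eqVlt => /predU1P[n0|n0].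
  near=> y; exists phi; last by rewrite dual_dist_refl.
  split=> // w _; apply: cabs_eq0; apply/eqP; rewrite eq_le cabs_ge0 andbT.
  by apply: le_trans (dual_norm_ub nrmP _ dphi) _; rewrite -/n -n0 mul0r.
have [_ _ dZ] := dualspace_lin_subspace nrmP.
pose phi' a := (n^-1%:C)%C * phi a.
have dphi' : dualspace nrm phi' by exact: dZ.
have phi'1 : dual_norm nrm phi' = 1.
  by rewrite dual_normZ// cabs_real gtr0_norm ?invr_gt0// mulVf// gt_eqF.
have aphi' : annih nrm (kappa x) phi'.
  by split => // w kw; rewrite /phi' phi0// mulr0.
have [a a1 phia] := reflexive_norm_attained nrmP refl dphi'.
rewrite phi'1 in phia.
have na1 : nrm a = 1.
  apply/eqP; rewrite eq_le a1/=.
  have := dual_norm_ub nrmP a dphi'.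
  by rewrite phia cabs_real normr1 phi'1 mul1r.
(* Division by [n] accounts for the normalization of [phi]; the half makes the final inequality
   strict. *)
have e'0 : 0 < e / 2 / n by rewrite !divr_gt0.
have [del del0 delP] := frechet_smooth_dual_close nrmP fs na1 e'0.
have [d d0 [N Nx NP]] := cont a x I _ del0.
apply: filterS Nx => y /(NP a y I); rewrite ndist_refl// => /(_ d0).
rewrite ltr_norml => /andP[+ _].
have := annih_le_setdist nrmP (linkappa x) a aphi' ltac:(by rewrite phi'1).
rewrite phia cabs_real normr1 => D1 hy.
(* Here [psi a] is the distance from [a] to [kappa y], which exceeds [1 - del]. *)
have [psi [[dpsi psi0] psi1 psia]] := annih_attains_setdist nrmP (linkappa y) a.
exists (fun a => (n%:C)%C * psi a).
  by split=> [|w kw]; [exact: dZ|rewrite psi0// mulr0].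
have -> : dual_dist nrm phi (fun a => (n%:C)%C * psi a) =
    n * dual_dist nrm phi' psi.
  rewrite -[in RHS](gtr0_norm n0) -cabs_real -dual_normZ//; last exact: dualspaceB.
  congr (dual_norm nrm _); apply/funext => b.
  by rewrite mulrBr /phi' mulrA -rmorphM divff ?gt_eqF// mul1r.
rewrite mulrC -ltr_pdivlMr//.
apply: le_lt_trans (delP phi' psi dphi' dpsi _ psi1 phia _) _.
- by rewrite phi'1.
- by rewrite psia /=; lra.
- by rewrite ltr_pM2r ?invr_gt0//; lra.
Unshelve. all: by end_near.
Qed.

End bundles.

Theorem theorem7p15 (R : realType) (V : lmodType R[i]) (nrm : V -> R)
  (X : topologicalType) (kappa : X -> set V) :
  is_cnorm nrm ->
  (forall x, closed_subspace nrm (kappa x)) ->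
  [/\ (* (1) *)
      (quotient_vb setT (ndist nrm) kappa ->
       quotient_vb (dualspace nrm) (dual_dist nrm) (fun x => annih nrm (kappa x)) ->
       cont_normed_qvb setT (ndist nrm) kappa /\
       cont_normed_qvb (dualspace nrm) (dual_dist nrm) (fun x => annih nrm (kappa x))),
      (* (2) *)
      (loc_unif_convex nrm ->
       cont_normed_qvb (dualspace nrm) (dual_dist nrm) (fun x => annih nrm (kappa x)) ->
       cont_normed_qvb setT (ndist nrm) kappa) &
      (* (3) *)
      (reflexive_space nrm -> frechet_smooth nrm ->
       cont_normed_qvb setT (ndist nrm) kappa ->
       cont_normed_qvb (dualspace nrm) (dual_dist nrm) (fun x => annih nrm (kappa x)))].
Proof.
move=> nrmP kappaP; split=> [qvb qvbV|luc contV|refl fs cont].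
- by split; [exact: cont_normed_qvb_of_dual_qvb|exact: dual_cont_normed_qvb_of_qvb].
(* In the last two parts, the missing lower Vietoris continuity is recovered first, and then the
   semicontinuity argument of the first part applies. *)
- have qvb := qvb_of_dual_cont_normed nrmP kappaP luc contV.
  by apply: cont_normed_qvb_of_dual_qvb => //; case: contV.
- have qvbV := dual_qvb_of_cont_normed nrmP kappaP refl fs cont.
  by apply: dual_cont_normed_qvb_of_qvb => //; case: cont.
Qed.
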